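(* Let $\mathcal{A}\in\mathbb{R}^{n\times n\times\cdots\times n}$ be a $K$-order real tensor, let $p\ge 1$ be a real number, let $i\in\{1,\dots,K\}$, and let $\sigma\in S_K$ be a non-identity permutation with $\sigma(i)=i$. Then the mode-$i$ $l^p$-eigenpairs are invariant under the transpose associated with $\sigma$: a pair $(\lambda,x)$ with $\lambda\in\mathbb{R}$ and $x\in\mathbb{R}^n$ is a mode-$i$ eigenpair of $\mathcal{A}$ if and only if it is a mode-$i$ eigenpair of $\mathcal{A}^{T\sigma}$.
   Context: Tensor transpose: for a non-identity permutation $\sigma\in S_K$ and a $K$-order tensor $\mathcal{A}$ of size $I_1\times\cdots\times I_K$, the transpose $\mathcal{A}^{T\sigma}$ is the tensor of size $I_{\sigma(1)}\times\cdots\times I_{\sigma(K)}$ with entries $\mathcal{A}^{T\sigma}(i_{\sigma(1)},\dots,i_{\sigma(K)})=\mathcal{A}(i_1,\dots,i_K)$ for all indices. (Here all $I_k=n$.) For $x\in\mathbb{R}^n$ and $i\in\{1,\dots,K\}$, let $\mathcal{A}(x,\dots,x,I_n,x,\dots,x)$, with the $n\times n$ identity matrix $I_n$ in the $i$-th slot and $x$ in all others, denote the vector in $\mathbb{R}^n$ obtained by contracting every mode of $\mathcal{A}$ except the $i$-th with $x$; its $j$-th entry is the sum, over all indices $(j_1,\dots,j_K)\in\{1,\dots,n\}^K$ with $j_i=j$, of $\mathcal{A}(j_1,\dots,j_K)\prod_{k\ne i}x_{j_k}$. Let $\varphi_{p-1}(x)=[\operatorname{sgn}(x_1)|x_1|^{p-1},\dots,\operatorname{sgn}(x_n)|x_n|^{p-1}]$,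 where $\operatorname{sgn}$ is the sign function. A pair $(\lambda,x)$ with $\lambda\in\mathbb{R}$ and $x\in\mathbb{R}^n$ a unit vector ($\|x\|_p=1$) is a mode-$i$ ($l^p$-)eigenpair of $\mathcal{A}$ if $\mathcal{A}(x,\dots,x,I_n,x,\dots,x)=\lambda\,\varphi_{p-1}(x)$, with $I_n$ in the $i$-th slot; then $x$ is called a mode-$i$ eigenvector and $\lambda$ the corresponding mode-$i$ eigenvalue. *)

(* Defs.v *)
From HB Require Import structures.
From mathcomp Require Import all_boot all_order all_algebra all_fingroup.
From mathcomp Require Import all_classical all_reals all_analysis.

Set Implicit Arguments.
Unset Strict Implicit.
Unset Printing Implicit Defensive.

Import Order.TTheory GRing.Theory Num.Theory.
Local Open Scope ring_scope.

(* A multi-index (j_1, ..., j_K) in {1, ..., n}^K, with indices shifted to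
   start at 0. *)
Definition multi_index (n K : nat) := {ffun 'I_K -> 'I_n}.

Definition tensor (R : realType) (n K : nat) := {ffun multi_index n K -> R}.

(* The transpose is specified by
     A^{T s} (i_{s(1)}, ..., i_{s(K)}) = A (i_1, ..., i_K);
   solving j_k = i_{s(k)} for i gives i_k = j_{s^-1(k)}, see
   [tensor_transposeE]. *)
Definition tensor_transpose (R : realType) (n K : nat) (s : 'S_K)
    (A : tensor R n K) : tensor R n K :=
  [ffun j : multi_index n K => A [ffun k => j ((s^-1)%g k)]].

Lemma tensor_transposeE (R : realType) (n K : nat) (s : 'S_K)
    (A : tensor R n K) (i : multi_index n K) :
  tensor_transpose s A [ffun k => i (s k)] = A i.
Proof.
by rewrite ffunE; congr (A _); apply/ffunP => k; rewrite !ffunE permKV.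
Qed.

(* A(x, ..., x, I_n, x, ..., x) with the identity matrix in slot [i]. *)
Definition mode_contraction (R : realType) (n K : nat) (A : tensor R n K)
    (i : 'I_K) (x : 'rV[R]_n) : 'rV[R]_n :=
  \row_(j < n) \sum_(f : multi_index n K | f i == j)
    A f * \prod_(k < K | k != i) x ord0 (f k).

Definition lp_norm (R : realType) (n : nat) (p : R) (x : 'rV[R]_n) : R :=
  (\sum_(j < n) `|x ord0 j| `^ p) `^ p^-1.

(* [phi q x] is the vector with entries sgn(x_j) |x_j|^q. The library sets
   0 `^ 0 = 1, which is harmless here since the factor sgn(0) = 0. *)
Definition phi (R : realType) (n : nat) (q : R) (x : 'rV[R]_n) : 'rV[R]_n :=
  \row_(j < n) (Num.sg (x ord0 j) * `|x ord0 j| `^ q).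

Definition mode_eigenpair (R : realType) (n K : nat) (p : R)
    (A : tensor R n K) (i : 'I_K) (lambda : R) (x : 'rV[R]_n) : Prop :=
  lp_norm p x = 1 /\ mode_contraction A i x = lambda *: phi (p - 1) x.

(* Main.v *)
Require Import Defs.
From HB Require Import structures.
From mathcomp Require Import all_boot all_order all_algebra all_fingroup.
From mathcomp Require Import all_classical all_reals all_analysis.

Set Implicit Arguments.
Unset Strict Implicit.
Unset Printing Implicit Defensive.

Import Order.TTheory GRing.Theory Num.Theory.
Local Open Scope ring_scope.

(** The eigenpair equation sees the tensor only through its mode-[i] contraction. Every slot other
    than [i] receives the same vector [x], so a permutation of the slots that fixes [i] merely
    relabels the terms of that sum; this is [mode_contraction_transpose]. *)

Lemma mode_contraction_transpose (R : realType) (n K : nat) (A : tensor R n K)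
    (i : 'I_K) (s : 'S_K) (x : 'rV[R]_n) :
  s i = i -> mode_contraction (tensor_transpose s A) i x = mode_contraction A i x.
Proof.
move=> si; apply/rowP => j; rewrite !mxE.
(* Substituting [f \o s] for the summation index turns each entry of the transpose into [A f]; the
   constraint at slot [i] survives because [s i = i]. *)
rewrite (reindex (fun f : multi_index n K => [ffun k => f (s k)])) /=; last first.
  exists (fun f : multi_index n K => [ffun k => f ((s^-1)%g k)]) => f _;
  by apply/ffunP => k; rewrite !ffunE ?permK ?permKV.
apply: eq_big => [f|f _]; first by rewrite ffunE si.
rewrite tensor_transposeE; congr (_ * _).
(* The factors now match up to [s], which permutes the slots other than [i] among themselves. *)
rewrite [RHS](reindex_inj (@perm_inj _ s)) /=.
apply: eq_big => [k|k _]; last by rewrite ffunE.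
by rewrite -{2}si (inj_eq perm_inj).
Qed.

Theorem proposition4p1 (R : realType) (n K : nat) (A : tensor R n K) (p : R)
    (hp : 1 <= p) (i : 'I_K) (s : 'S_K) (hs : s != 1%g) (hsi : s i = i)
    (lambda : R) (x : 'rV[R]_n) :
  mode_eigenpair p A i lambda x <->
  mode_eigenpair p (tensor_transpose s A) i lambda x.
Proof. by rewrite /mode_eigenpair mode_contraction_transpose. Qed.
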